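(* Let $p,q$ be two integers and let $n$ be a positive integer. Let $G^{p,q}_n=g^{p,q}_n+g^{p,q}_{n+1}i+g^{p,q}_{n+2}j+g^{p,q}_{n+3}k$ be the $n$-th generalized Fibonacci-Lucas quaternion in $\mathbb{H}_{\mathbb{Z}_2}(-1,-1)$. Then: (i) if $p\equiv 0\pmod 2$ and $q\equiv 1\pmod 2$, then $G^{p,q}_n$ is a zero divisor in $\mathbb{H}_{\mathbb{Z}_2}(-1,-1)$ if and only if $n\equiv 0\pmod 3$; (ii) if $p\equiv 1\pmod 2$ and $q\equiv 0\pmod 2$, then $G^{p,q}_n$ is a zero divisor in $\mathbb{H}_{\mathbb{Z}_2}(-1,-1)$ if and only if $n\equiv 1\pmod 3$; (iii) if $p\equiv q\equiv 0\pmod 2$, then $G^{p,q}_n$ is a zero divisor in $\mathbb{H}_{\mathbb{Z}_2}(-1,-1)$ (for every $n$); (iv) if $p\equiv q\equiv 1\pmod 2$, then $G^{p,q}_n$ is a zero divisor in $\mathbb{H}_{\mathbb{Z}_2}(-1,-1)$ if and only if $n\equiv 2\pmod 3$.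
   Context: $(f_n)_{n\ge 0}$ is the Fibonacci sequence ($f_0=0$, $f_1=1$, $f_n=f_{n-1}+f_{n-2}$ for $n\ge2$) and $(l_n)_{n\ge 0}$ the Lucas sequence ($l_0=2$, $l_1=1$, $l_n=l_{n-1}+l_{n-2}$ for $n\ge2$). For integers $p,q$ the generalized Fibonacci-Lucas numbers are $g^{p,q}_{n+1}=p f_n+q\, l_{n+1}$, $n\ge 0$. For a prime $r$, $\mathbb{Z}_r=\mathbb{Z}/r\mathbb{Z}$, and $\mathbb{H}_{\mathbb{Z}_r}(-1,-1)$ is the 4-dimensional associative unital $\mathbb{Z}_r$-algebra with basis $\{1,i,j,k\}$ and relations $i^2=j^2=-1$, $k=ij=-ji$. Integer coefficients are reduced modulo $r$. An element $x$ of a ring is a zero divisor if there is a nonzero $y$ with $xy=0$ or $yx=0$ (so $0$ counts as a zero divisor). *)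

(* Defs.v *)
From HB Require Import structures.
From mathcomp Require Import all_boot all_order all_algebra.
From mathcomp Require Import ring.
Set Implicit Arguments.
Unset Strict Implicit.
Unset Printing Implicit Defensive.
Import GRing.Theory.
Local Open Scope ring_scope.

Fixpoint fib (n : nat) : nat :=
  match n with
  | 0 => 0
  | n'.+1 => match n' with 0 => 1 | n''.+1 => fib n' + fib n'' end
  end%N.

Fixpoint lucas (n : nat) : nat :=
  match n with
  | 0 => 2
  | n'.+1 => match n' with 0 => 1 | n''.+1 => lucas n' + lucas n'' end
  end%N.

(* The sequence is indexed from 1; the value at index 0 is a junk value. *)
Definition gfl (p q : int) (n : nat) : int :=
  if n is m.+1 then p * (fib m)%:Z + q * (lucas m.+1)%:Z else 0.

(* [quat a b] is the quaternion algebra H_R(a, b), free over [R] on the basis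
   1, i, j, k, with i^2 = a, j^2 = b and k = ij = -ji. *)
Record quat (R : comNzRingType) (a b : R) :=
  Quat { qcoef1 : R; qcoefi : R; qcoefj : R; qcoefk : R }.

Arguments Quat {R a b}.

Section QuaternionAlgebra.

Variables (R : comNzRingType) (a b : R).
Local Notation H := (quat a b).
Implicit Types (x y z : H) (c d : R).

Definition quat_prod x : R * R * R * R :=
  (qcoef1 x, qcoefi x, qcoefj x, qcoefk x).
Definition prod_quat (t : R * R * R * R) : H :=
  let: (x1, xi, xj, xk) := t in Quat x1 xi xj xk.

Lemma quat_prodK : cancel quat_prod prod_quat.
Proof. by case. Qed.

HB.instance Definition _ := Choice.copy H (can_type quat_prodK).

Lemma quat_ext x y :
  qcoef1 x = qcoef1 y -> qcoefi x = qcoefi y ->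
  qcoefj x = qcoefj y -> qcoefk x = qcoefk y -> x = y.
Proof. by case: x y => [? ? ? ?] [? ? ? ?] /= -> -> -> ->. Qed.

Definition quat_zero : H := Quat 0 0 0 0.
Definition quat_opp x : H :=
  Quat (- qcoef1 x) (- qcoefi x) (- qcoefj x) (- qcoefk x).
Definition quat_add x y : H :=
  Quat (qcoef1 x + qcoef1 y) (qcoefi x + qcoefi y)
       (qcoefj x + qcoefj y) (qcoefk x + qcoefk y).

Fact quat_addA : associative quat_add.
Proof. by move=> x y z; apply: quat_ext; rewrite /= addrA. Qed.
Fact quat_addC : commutative quat_add.
Proof. by move=> x y; apply: quat_ext; rewrite /= addrC. Qed.
Fact quat_add0 : left_id quat_zero quat_add.
Proof. by move=> x; apply: quat_ext; rewrite /= add0r. Qed.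
Fact quat_addN : left_inverse quat_zero quat_opp quat_add.
Proof. by move=> x; apply: quat_ext; rewrite /= addNr. Qed.

HB.instance Definition _ :=
  GRing.isZmodule.Build H quat_addA quat_addC quat_add0 quat_addN.

Definition quat_one : H := Quat 1 0 0 0.

(* Bilinear extension of i^2 = a, j^2 = b, ij = k = -ji, whence
   k^2 = -ab, ik = aj = -ki and kj = bi = -jk. *)
Definition quat_mul x y : H :=
  let: Quat x1 xi xj xk := x in
  let: Quat y1 yi yj yk := y in
  Quat (x1 * y1 + a * (xi * yi) + b * (xj * yj) - a * b * (xk * yk))
       (x1 * yi + xi * y1 + b * (xk * yj - xj * yk))
       (x1 * yj + xj * y1 + a * (xi * yk - xk * yi))
       (x1 * yk + xk * y1 + xi * yj - xj * yi).

Fact quat_mulA : associative quat_mul.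
Proof.
by case=> [? ? ? ?] [? ? ? ?] [? ? ? ?]; apply: quat_ext => /=; ring.
Qed.
Fact quat_mul1l : left_id quat_one quat_mul.
Proof. by case=> [? ? ? ?]; apply: quat_ext => /=; ring. Qed.
Fact quat_mul1r : right_id quat_one quat_mul.
Proof. by case=> [? ? ? ?]; apply: quat_ext => /=; ring. Qed.
Fact quat_mulDl : left_distributive quat_mul +%R.
Proof.
by case=> [? ? ? ?] [? ? ? ?] [? ? ? ?]; apply: quat_ext => /=; ring.
Qed.
Fact quat_mulDr : right_distributive quat_mul +%R.
Proof.
by case=> [? ? ? ?] [? ? ? ?] [? ? ? ?]; apply: quat_ext => /=; ring.
Qed.
Fact quat_one_neq0 : quat_one != 0.
Proof. by apply/eqP => /(congr1 (@qcoef1 R a b)) /= /eqP; rewrite oner_eq0. Qed.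

HB.instance Definition _ := GRing.Zmodule_isNzRing.Build H
  quat_mulA quat_mul1l quat_mul1r quat_mulDl quat_mulDr quat_one_neq0.

Definition quat_scale c x : H :=
  Quat (c * qcoef1 x) (c * qcoefi x) (c * qcoefj x) (c * qcoefk x).

Fact quat_scaleA c d x : quat_scale c (quat_scale d x) = quat_scale (c * d) x.
Proof. by apply: quat_ext; rewrite /= mulrA. Qed.
Fact quat_scale1 : left_id 1 quat_scale.
Proof. by move=> x; apply: quat_ext; rewrite /= mul1r. Qed.
Fact quat_scaleDr : right_distributive quat_scale +%R.
Proof. by move=> c x y; apply: quat_ext; rewrite /= mulrDr. Qed.
Fact quat_scaleDl x : {morph quat_scale^~ x : c d / c + d}.
Proof. by move=> c d; apply: quat_ext; rewrite /= mulrDl. Qed.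

HB.instance Definition _ := GRing.Zmodule_isLmodule.Build R H
  quat_scaleA quat_scale1 quat_scaleDr quat_scaleDl.

Fact quat_scaleAl c x y : c *: (x * y) = (c *: x) * y.
Proof. by case: x y => [? ? ? ?] [? ? ? ?]; apply: quat_ext => /=; ring. Qed.

HB.instance Definition _ := GRing.Lmodule_isLalgebra.Build R H quat_scaleAl.

Fact quat_scaleAr c x y : c *: (x * y) = x * (c *: y).
Proof. by case: x y => [? ? ? ?] [? ? ? ?]; apply: quat_ext => /=; ring. Qed.

HB.instance Definition _ := GRing.Lalgebra_isAlgebra.Build R H quat_scaleAr.

Definition quat_i : H := Quat 0 1 0 0.
Definition quat_j : H := Quat 0 0 1 0.
Definition quat_k : H := Quat 0 0 0 1.

Lemma quat_basisE (x1 xi xj xk : R) :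
  x1%:A + xi *: quat_i + xj *: quat_j + xk *: quat_k = Quat x1 xi xj xk :> H.
Proof. by apply: quat_ext => /=; ring. Qed.

Lemma quat_ii : quat_i * quat_i = a%:A.
Proof. by apply: quat_ext => /=; ring. Qed.
Lemma quat_jj : quat_j * quat_j = b%:A.
Proof. by apply: quat_ext => /=; ring. Qed.
Lemma quat_ij : quat_i * quat_j = quat_k.
Proof. by apply: quat_ext => /=; ring. Qed.
Lemma quat_ji : quat_j * quat_i = - quat_k.
Proof. by apply: quat_ext => /=; ring. Qed.

End QuaternionAlgebra.

Arguments quat_i {R a b}.
Arguments quat_j {R a b}.
Arguments quat_k {R a b}.

Definition gfl_quat (R : comNzRingType) (p q : int) (n : nat) :
    quat (-1 : R) (-1) :=
  (gfl p q n)%:~R%:A + (gfl p q n.+1)%:~R *: quat_i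
  + (gfl p q n.+2)%:~R *: quat_j + (gfl p q n.+3)%:~R *: quat_k.

(* Left or right; with this convention 0 is a zero divisor. *)
Definition zero_divisor (A : nzRingType) (x : A) : Prop :=
  exists2 y : A, y != 0 & x * y = 0 \/ y * x = 0.

(* Main.v *)
Require Import Defs.
From mathcomp Require Import all_boot all_order all_algebra.
From mathcomp Require Import ring zify.
Local Open Scope ring_scope.
Import GRing.Theory.

(** In characteristic 2 the algebra H(-1, -1) is commutative and squaring is
    additive, so, as i^2 = j^2 = k^2 = -1 = 1, the square of a quaternion is the
    scalar s^2, where s is the sum of its four coefficients
    ([quat_sqr_pchar2]).  Over a field, a quaternion with s != 0 is therefore
    invertible, while one with s = 0 is nilpotent: the zero divisors are exactly
    the quaternions with s = 0 ([zero_divisor_pchar2]).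

    For G_n = g_n + g_(n+1) i + g_(n+2) j + g_(n+3) k, the Fibonacci recurrence
    g_n + g_(n+1) = g_(n+2) makes s equal to 2 g_(n+2) + g_(n+3), that is, to
    g_(n+3) = p f_(n+2) + q l_(n+3) modulo 2.  Both f_m and l_m are even exactly
    when 3 divides m, so f_(n+2) vanishes modulo 2 for n = 1 modulo 3, l_(n+3)
    for n = 0 modulo 3, and their sum in the remaining class n = 2 modulo 3. *)

(** The recurrence applied twice gives fib (m + 3) = 2 fib (m + 1) + fib m, so
    the parity has period 3. *)
Lemma odd_fib m : odd (fib m) = ~~ (3 %| m)%N.
Proof.
have step k : odd (fib k.+3) = odd (fib k).
  have -> : fib k.+3 = (fib k.+1 + fib k + fib k.+1)%N by [].
  by rewrite !oddD; case: (odd (fib k)); case: (odd (fib k.+1)).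
suff [] : odd (fib m) = ~~ (3 %| m)%N /\
  odd (fib m.+1) = ~~ (3 %| m.+1)%N /\ odd (fib m.+2) = ~~ (3 %| m.+2)%N by [].
elim: m => [//|m [IH0 [IH1 IH2]]]; do !split=> //.
by rewrite step IH0 -[m.+3]addn3 dvdn_addl.
Qed.

(** The two sequences satisfy the same recurrence and agree modulo 2 at 0
    and 1. *)
Lemma odd_lucas m : odd (lucas m) = odd (fib m).
Proof.
suff [] : odd (lucas m) = odd (fib m) /\ odd (lucas m.+1) = odd (fib m.+1) by [].
elim: m => [//|m [IH0 IH1]]; split=> //.
have -> : lucas m.+2 = (lucas m.+1 + lucas m)%N by [].
have -> : fib m.+2 = (fib m.+1 + fib m)%N by [].
by rewrite !oddD IH0 IH1.
Qed.

Lemma gfl_rec p q n : (0 < n)%N -> gfl p q n.+2 = gfl p q n.+1 + gfl p q n.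
Proof.
case: n => // n _.
have fE : fib n.+2 = (fib n.+1 + fib n)%N by [].
have lE : lucas n.+3 = (lucas n.+2 + lucas n.+1)%N by [].
by rewrite /gfl fE lE !PoszD; ring.
Qed.

Section Characteristic2.

Variables (F : fieldType) (charF2 : 2%N \in [pchar F]).

Let two0 : 2 = 0 :> F. Proof. exact: pcharf0 charF2. Qed.

Definition qcoef_sum {a b : F} (x : quat a b) : F :=
  qcoef1 x + qcoefi x + qcoefj x + qcoefk x.

Lemma quat_sqr_pchar2 (x : quat (-1 : F) (-1)) :
  x * x = (qcoef_sum x ^+ 2)%:A.
Proof.
(* All cross terms, and all discrepancies of sign, are multiples of 2. *)
case: x => x1 xi xj xk.
have -> : Quat x1 xi xj xk * Quat x1 xi xj xk =
    (qcoef_sum (Quat x1 xi xj xk : quat (-1 : F) (-1)) ^+ 2)%:A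
    + 2 *: Quat (- (xi ^+ 2 + xj ^+ 2 + xk ^+ 2 + x1 * (xi + xj + xk)
                    + xi * (xj + xk) + xj * xk))
                (x1 * xi) (x1 * xj) (x1 * xk) :> quat (-1 : F) (-1).
  by apply: quat_ext; rewrite /qcoef_sum /=; ring.
by rewrite two0 scale0r addr0.
Qed.

Lemma zero_divisor_pchar2 (x : quat (-1 : F) (-1)) :
  zero_divisor x <-> qcoef_sum x = 0.
Proof.
have sqrx := quat_sqr_pchar2 x; split=> [[y y0 xy0] | s0].
  (* Multiplying by x once more turns an annihilator of x into one of s^2. *)
  have sy0 : qcoef_sum x ^+ 2 *: y = 0.
    case: xy0 => xy0.
      by rewrite -[y]mul1r scalerAl -sqrx -mulrA xy0 mulr0.
    by rewrite -[y]mulr1 scalerAr -sqrx mulrA xy0 mul0r.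
  by move/eqP: sy0; rewrite scaler_eq0 (negPf y0) orbF expf_eq0 => /eqP.
have [-> | x0] := eqVneq x 0.
  by exists 1; [exact: oner_neq0 | left; rewrite mul0r].
by exists x => //; left; rewrite sqrx s0 expr0n scale0r.
Qed.

Lemma qcoef_sum_gfl_quat p q n : (0 < n)%N ->
  qcoef_sum (gfl_quat F p q n) = (gfl p q n.+3)%:~R.
Proof.
move=> n0; rewrite /gfl_quat quat_basisE (gfl_rec p q n n0) intrD.
move: (gfl p q n)%:~R (gfl p q n.+1)%:~R (gfl p q n.+3)%:~R => g h t.
rewrite /qcoef_sum /=.
have -> : g + h + (h + g) + t = 2 * (g + h) + t by ring.
by rewrite two0 mul0r add0r.
Qed.

Lemma natr_odd_pchar2 m : m%:R = (odd m)%:R :> F.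
Proof.
by rewrite -[in LHS](odd_double_half m) natrD -muln2 natrM two0 mulr0 addr0.
Qed.

Lemma intr_modz2_pchar2 (x y : int) :
  (x = y %[mod 2])%Z -> x%:~R = y%:~R :> F.
Proof.
move=> xy; rewrite (divz_eq x 2) (divz_eq y 2) xy !intrD !intrM.
by rewrite -[2%:~R]/(2 : F) two0 !mulr0.
Qed.

Lemma zero_divisor_gfl_quat (p q a b : int) n : (0 < n)%N ->
  (p = a %[mod 2])%Z -> (q = b %[mod 2])%Z ->
  zero_divisor (gfl_quat F p q n) <->
  a%:~R * (~~ (3 %| n.+2)%N)%:R + b%:~R * (~~ (3 %| n.+3)%N)%:R = 0 :> F.
Proof.
move=> n0 /intr_modz2_pchar2 pa /intr_modz2_pchar2 qb.
rewrite zero_divisor_pchar2 qcoef_sum_gfl_quat //.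
have -> : gfl p q n.+3 = p * (fib n.+2)%:Z + q * (lucas n.+3)%:Z by [].
rewrite intrD !intrM pa qb -!pmulrn natr_odd_pchar2.
by rewrite [(lucas _)%:R]natr_odd_pchar2 odd_lucas !odd_fib.
Qed.

End Characteristic2.

Theorem proposition3p2 (p q : int) (n : nat) (n_gt0 : (0 < n)%N) :
  [/\ (p = 0 %[mod 2])%Z -> (q = 1 %[mod 2])%Z ->
        (zero_divisor (gfl_quat 'F_2 p q n) <-> (n = 0 %[mod 3])%N),
      (p = 1 %[mod 2])%Z -> (q = 0 %[mod 2])%Z ->
        (zero_divisor (gfl_quat 'F_2 p q n) <-> (n = 1 %[mod 3])%N),
      (p = 0 %[mod 2])%Z -> (q = 0 %[mod 2])%Z ->
        zero_divisor (gfl_quat 'F_2 p q n)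
    & (p = 1 %[mod 2])%Z -> (q = 1 %[mod 2])%Z ->
        (zero_divisor (gfl_quat 'F_2 p q n) <-> (n = 2 %[mod 3])%N)].
Proof.
have charF2 : 2%N \in [pchar 'F_2] by exact: pchar_Fp.
have n3 : (n %% 3 < 3)%N by exact: ltn_pmod.
have d2 : (3 %| n.+2)%N = (n %% 3 == 1)%N by lia.
have d3 : (3 %| n.+3)%N = (n %% 3 == 0)%N by lia.
(* Once n modulo 3 is fixed, each claim is a computation in the field with two
   elements. *)
split=> pa qb; rewrite (zero_divisor_gfl_quat _ charF2 _ _ _ _ _ n_gt0 pa qb);
  rewrite d2 d3; case: (n %% 3)%N n3 => [|[|[|]]] //= _.
all: by [exact/eqP | split=> // _; exact/eqP].
Qed.
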